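(* Let $n\in\mathbb{N}_0$, let $b\in(0,\infty)$, and let $p,r\in\mathbb{R}[x]$ be polynomials of degree at most $n$ such that $\operatorname{mesh}(p)\ge b$ and $\operatorname{mesh}(r)\ge b$. Then $\operatorname{mesh}(p\boxplus_b^n r)\ge b$.
   Context: For $p\in\mathbb{R}[x]$ with all roots real, $p$ is called $b$-mesh, written $\operatorname{mesh}(p)\ge b$, if the minimum non-negative difference of any pair of roots of $p$ (roots counted with multiplicity, so that a multiple root gives difference $0$) is at least $b$. The assertion $\operatorname{mesh}(p)\ge b$ includes that all roots of $p$ are real; if $p$ has at most one root the condition on differences is vacuous. The zero polynomial is regarded as satisfying $\operatorname{mesh}\ge b$. The $b$-difference operator is $(\Delta_b p)(x):=\dfrac{p(x)-p(x-b)}{b}$, and the $b$-additive convolution (finite difference convolution) of polynomials $p,r$ of degree at most $n$ is $$p\boxplus_b^n r:=\sum_{k=0}^n \Delta_b^k p\cdot(\Delta_b^{n-k}r)(0).$$ *)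

(* Defs.v *)
From HB Require Import structures.
From mathcomp Require Import all_boot all_order all_algebra.
From mathcomp Require Import reals.
From mathcomp Require Import complex.

Set Implicit Arguments.
Unset Strict Implicit.
Unset Printing Implicit Defensive.

Import Order.TTheory GRing.Theory Num.Theory.
Local Open Scope ring_scope.

(* [rs] is the list of all roots of the nonzero polynomial [p], repeated
   according to multiplicity; such a list of elements of [R] exists iff all
   complex roots of [p] are real, see [real_rootedP]. *)
Definition root_list (R : realType) (p : {poly R}) (rs : seq R) : Prop :=
  p = lead_coef p *: \prod_(a <- rs) ('X - a%:P).

(* [pairwise] ranges over pairs of positions i < j in the list, so a multiple
   root contributes the difference 0. *)
Definition mesh_ge (R : realType) (b : R) (p : {poly R}) : Prop :=
  p = 0 \/
  exists2 rs : seq R, root_list p rs & pairwise (fun x y => b <= `|x - y|) rs.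

Definition fdiff (R : realType) (b : R) (p : {poly R}) : {poly R} :=
  b^-1 *: (p - (p \Po ('X - b%:P))).

Definition fdconv (R : realType) (b : R) (n : nat) (p r : {poly R}) : {poly R} :=
  \sum_(k < n.+1) (iter (n - k) (fdiff b) r).[0] *: iter k (fdiff b) p.

Lemma horner_fdiff (R : realType) (b : R) (p : {poly R}) (x : R) :
  (fdiff b p).[x] = (p.[x] - p.[x - b]) / b.
Proof. by rewrite /fdiff hornerZ hornerD hornerN horner_comp hornerXsubC mulrC. Qed.

Lemma real_rootedP (R : realType) (p : {poly R}) : p != 0 ->
  (forall z : complex R, root (map_poly (real_complex R) p) z -> complex.Im z = 0)
  <-> exists rs : seq R, root_list p rs.
Proof.
move=> p0; split=> [real_p | [rs ->] z].
- have [s Es] := closed_field_poly_normal (map_poly (real_complex R) p).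
  exists (map (@complex.Re R) s).
  apply: (map_inj_poly (f := real_complex R)) => //.
  - exact: fmorph_inj.
  - rewrite map_polyZ rmorph_prod big_map -lead_coef_map {1}Es.
    congr (_ *: _); apply: eq_big_seq => z zs.
    rewrite rmorphB /= map_polyX map_polyC /=; congr (_ - _%:P).
    have := real_p z; rewrite Es rootZ ?root_prod_XsubC; last first.
      by rewrite lead_coef_eq0 map_poly_eq0.
    by move=> /(_ zs); case: z {zs} => x y /= ->.
- rewrite map_polyZ rootZ; last by rewrite fmorph_eq0 lead_coef_eq0.
  rewrite rmorph_prod /=.
  under eq_bigr => a _ do rewrite rmorphB /= map_polyX map_polyC /=.
  rewrite -(big_map (real_complex R) xpredT (fun z => 'X - z%:P)).
  by rewrite root_prod_XsubC => /mapP[x _ ->].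
Qed.

(* Main.v *)
Require Import Defs.
From HB Require Import structures.
From mathcomp Require Import all_boot all_order all_algebra.
From mathcomp Require Import reals polyrcf zify ring lra.

Set Implicit Arguments.
Unset Strict Implicit.
Unset Printing Implicit Defensive.

Import Order.TTheory GRing.Theory Num.Theory.
Local Open Scope ring_scope.

(** The convolution is not linear in the roots, but it respects their order, and
    this carries the proof.  Write the roots of a polynomial with gaps at least
    [b] as an increasing vector.  The induction on the degree [n] proves three
    statements at once ([conv_interlacing_laws]): the convolution of two such
    polynomials of degree [n] again has such a root vector; that vector
    increases when one of the root vectors increases; and it interlaces when one
    of the root vectors is replaced by an interlacing one.

    The gap statement is a special case of the interlacing statement: the
    convolution commutes with translation by [b], and a root vector [a] has gaps
    at least [b] exactly when [a + b] interlaces [a] from above, so the same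
    relation holds for the roots of the convolution.  Likewise monotonicity and
    interlacing for all root vectors reduce to moving a single root.

    For the step in the degree, let [r] have roots [c_0 <= ... <= c_n].  Moving
    the roots of [r] to the right by [b] one after the other gives a telescoping
    sum [fdiff b r = g_0 + ... + g_n] ([fdiff_rp]), where each [g_j] has degree
    [n], gaps at least [b], and roots that decrease with [j].  A product rule
    for the convolution ([fdconv_mulX]) then gives, for [q] of degree [n],
    with [P] the convolution of [(X - al) q] and [r] in degree [n.+1], [G_j] that
    of [q] and [g_j] in degree [n], and [A] the sum of the [G_j],
      [P = (X - al) A - sum_j (c_j + b j) G_j]
    ([fdconv_mulXsubC]).  At a root of [A] the values [G_j] sum to zero and, by
    the induction hypothesis, change sign at most once as [j] increases; since
    the weights [c_j + b j] increase, the weighted sum has a determined sign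
    there.  Hence the roots of [A] interlace those of [P], whatever [al] is ([conv_interlacing]).  Two choices of [al] give
    polynomials that differ by a multiple of [A], with which both interlace;
    their root vectors are then ordered like the two values of [al]
    ([common_interlacing_le]).

    Polynomials of degree below [n] reduce to full degree, because convolving in
    degree [n.+1] with a polynomial of degree at most [n] is convolving in
    degree [n] with the difference of the other factor ([fdconvS]), and
    differences preserve the mesh condition ([fdiff_rp_roots]). *)

(** * Polynomials with prescribed roots *)

Definition rp (R : realType) (n : nat) (t : nat -> R) : {poly R} :=
  \prod_(i < n) ('X - (t i)%:P).

Definition spaced (R : realType) (b : R) (n : nat) (t : nat -> R) : Prop :=
  forall i, (i.+1 < n)%N -> t i + b <= t i.+1.

Section RealRootedPolynomials.
Variable R : realType.
Implicit Types (p q Q : {poly R}) (s t u : nat -> R) (b x y : R).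

Lemma eq_rp n s t : (forall i, (i < n)%N -> s i = t i) -> rp n s = rp n t.
Proof. by move=> st; apply: eq_bigr => i _; rewrite st. Qed.

Lemma rp0 t : rp 0 t = 1. Proof. exact: big_ord0. Qed.

Lemma rpSl n t : rp n.+1 t = ('X - (t 0)%:P) * rp n (fun i => t i.+1).
Proof. exact: big_ord_recl. Qed.

Lemma rpSr n t : rp n.+1 t = ('X - (t n)%:P) * rp n t.
Proof. by rewrite /rp big_ord_recr mulrC. Qed.

Lemma rp_del n k t : (k <= n)%N ->
  rp n.+1 t = ('X - (t k)%:P) * rp n (fun i => t (bump k i)).
Proof.
rewrite -ltnS => kn; rewrite /rp (bigD1_ord (Ordinal kn)) //.
Qed.

Lemma monic_rp n t : rp n t \is monic.
Proof. by apply: monic_prod => i _; apply: monicXsubC. Qed.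

Lemma size_rp n t : size (rp n t) = n.+1.
Proof.
elim: n => [|n IH]; first by rewrite rp0 size_poly1.
by rewrite rpSr size_monicM ?monicXsubC ?monic_neq0 ?monic_rp // size_XsubC IH.
Qed.

Lemma horner_rp n t x : (rp n t).[x] = \prod_(i < n) (x - t i).
Proof. by rewrite horner_prod; apply: eq_bigr => i _; rewrite hornerXsubC. Qed.

Lemma horner_rp_root n t i : (i < n)%N -> (rp n t).[t i] = 0.
Proof.
by move=> i_n; rewrite horner_rp (bigD1 (Ordinal i_n)) //= subrr mul0r.
Qed.

(** Each of the [n - k] roots above [x] contributes one negative factor; the
    exponent [n + k] has the parity of [n - k]. *)
Lemma rp_sign n k t x : (k <= n)%N ->
  (forall i, (i < k)%N -> t i <= x) ->
  (forall i, (k <= i < n)%N -> x <= t i) ->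
  0 <= (-1) ^+ (n + k) * (rp n t).[x].
Proof.
elim: n => [|n IH] kn lo hi.
  by move: kn; rewrite leqn0 => /eqP->; rewrite rp0 hornerC expr0 mul1r.
rewrite rpSr hornerM hornerXsubC.
have [kn'|nk] := ltnP n k.
  have ->: k = n.+1 by lia.
  rewrite -signr_odd addnn odd_double expr0 mul1r.
  rewrite mulr_ge0 ?subr_ge0 ?lo // horner_rp prodr_ge0 // => i _.
  by rewrite subr_ge0 lo // ltnW // (leq_trans _ kn') // ltnS.
rewrite addSn exprS.
rewrite (_ : _ * _ = (t n - x) * ((-1) ^+ (n + k) * (rp n t).[x])); last by ring.
rewrite mulr_ge0 ?subr_ge0 ?hi ?nk ?ltnSn // IH // => i /andP[ki ni].
by rewrite hi // ki ltnW.
Qed.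

Lemma rp_sign_lt n k t x : (k <= n)%N ->
  (forall i, (i < k)%N -> t i < x) ->
  (forall i, (k <= i < n)%N -> x < t i) ->
  0 < (-1) ^+ (n + k) * (rp n t).[x].
Proof.
move=> kn lo hi; rewrite lt_def rp_sign ?andbT // => [|i /lo /ltW //|i /hi /ltW //].
rewrite mulf_neq0 ?signr_eq0 // horner_rp; apply/prodf_neq0 => i _.
rewrite subr_eq0; have [ik|ki] := ltnP i k; first by rewrite gt_eqF // lo.
by rewrite lt_eqF // hi // ki ltn_ord.
Qed.

Lemma spaced_le b n t i j : 0 <= b -> spaced b n t ->
  (i <= j < n)%N -> t i <= t j.
Proof.
move=> b0 sp /andP[]; elim: j => [|j IH] ij jn.
  by move: ij; rewrite leqn0 => /eqP->.
move: ij; rewrite leq_eqVlt => /orP[/eqP->//|ij].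
by have := IH ij (ltnW jn); have := sp _ jn; lra.
Qed.

Lemma spaced_lt b n t i j : 0 < b -> spaced b n t ->
  (i < j < n)%N -> t i + b <= t j.
Proof.
move=> b0 sp /andP[ij jn].
by apply: le_trans (sp i _) (spaced_le (ltW b0) sp _); rewrite ?ij ?jn //; lia.
Qed.

Lemma sorted_rp_inj n s t : spaced 0 n s -> spaced 0 n t -> rp n s = rp n t ->
  forall i, (i < n)%N -> s i = t i.
Proof.
move=> ss st E i lin.
have mk u : rp n u = \prod_(x <- mkseq u n) ('X - x%:P).
  by rewrite big_map -{2}[n]subn0 big_mkord.
have srt u : spaced 0 n u -> sorted <=%R (mkseq u n).
  move=> su; apply/(sortedP 0) => j; rewrite size_mkseq => jn.
  by rewrite !nth_mkseq ?(ltnW jn) //; have := su _ jn; rewrite addr0.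
have := E; rewrite !mk => /prod_XsubC_eq perm.
have e := sorted_eq le_trans le_anti (srt _ ss) (srt _ st) perm.
by rewrite -(nth_mkseq 0 s lin) e nth_mkseq.
Qed.

(** Control of the sign of the quotient at [y] is what an induction on the number
    of sign changes needs.  It is immediate for a zero other than [y].  If
    [Q.[y] = 0] and splitting off [y] leaves a quotient that is positive at [y],
    then this quotient changes sign between [x] and [y], and its own zero is
    split off instead. *)
Lemma root_split Q x y : x < y -> 0 <= Q.[x] -> Q.[y] <= 0 ->
  exists z q, [/\ x <= z, z <= y, Q = ('X - z%:P) * q & q.[y] <= 0].
Proof.
move=> xy Qx Qy.
have split (P : {poly R}) z : root P z -> exists q, P = ('X - z%:P) * q.
  by case/factor_theorem=> q ->; exists q; rewrite mulrC.
have [Qx0|Qx0] := eqVneq Q.[x] 0.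
  have [q E] := split Q x (introT rootP Qx0); exists x, q; split; rewrite ?(ltW xy) //.
  by move: Qy; rewrite E hornerM hornerXsubC pmulr_rle0 // subr_gt0.
have {}Qx0 : 0 < Q.[x] by rewrite lt_def Qx0.
have [Qy0|Qy0] := eqVneq Q.[y] 0; last first.
  have {}Qy0 : Q.[y] < 0 by rewrite lt_neqAle Qy0.
  have sgn : (- Q).[x] <= 0 <= (- Q).[y].
    by rewrite !hornerN oppr_le0 oppr_ge0 (ltW Qx0) (ltW Qy0).
  have [z] := poly_ivt (ltW xy) sgn.
  move=> /andP[xz zy]; rewrite rootN => /[dup] rz /split[q E].
  have zy' : z < y.
    by rewrite lt_neqAle zy andbT; apply: contraTneq Qy0 => <-; rewrite (rootP rz) ltxx.
  exists z, q; split => //.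
  by move: Qy; rewrite E hornerM hornerXsubC pmulr_rle0 // subr_gt0.
have [q E] := split Q y (introT rootP Qy0).
have [qy|qy] := leP q.[y] 0; first by exists y, q; rewrite ltW.
have qx : q.[x] < 0.
  by move: Qx0; rewrite E hornerM hornerXsubC nmulr_rgt0 // subr_lt0.
have sgn : q.[x] <= 0 <= q.[y] by rewrite (ltW qx) (ltW qy).
have [z] := poly_ivt (ltW xy) sgn.
move=> /andP[xz zy] /split[q' E'].
exists z, (('X - y%:P) * q'); split => //; first by rewrite E E' mulrCA.
by rewrite hornerM hornerXsubC subrr mul0r.
Qed.

(** Signs are weak, so neighbouring intervals may share a zero; counting
    multiplicities correctly is what [root_split] achieves. *)
Lemma alternating_roots m Q s : (size Q <= m.+1)%N ->
  (forall i, (i < m)%N -> s i < s i.+1) ->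
  (forall i, (i <= m)%N -> 0 <= (-1) ^+ i * Q.[s i]) ->
  exists c t, Q = c *: rp m t /\
    forall i, (i < m)%N -> s i <= t i /\ t i <= s i.+1.
Proof.
elim: m Q s => [|m IH] Q s sz mono sg.
  exists Q`_0, s; split => //.
  by rewrite rp0 alg_polyC [LHS]size1_polyC.
have Q0 : 0 <= Q.[s 0] by have := sg 0%N isT; rewrite expr0 mul1r.
have Q1 : Q.[s 1%N] <= 0 by have := sg 1%N isT; rewrite expr1 mulN1r oppr_ge0.
have [z [q [sz0 zs1 E q1]]] := root_split (mono 0%N isT) Q0 Q1.
have szq : (size q <= m.+1)%N.
  have [->|q0] := eqVneq q 0; first by rewrite size_poly0.
  by move: sz; rewrite E size_monicM ?monicXsubC // size_XsubC.
have [|||c [t [Eq H]]] := IH (- q) (fun i => s i.+1).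
- by rewrite size_polyN.
- by move=> i im; apply: mono.
- move=> [|i] im; first by rewrite expr0 mul1r hornerN oppr_ge0.
  have zlt : z < s i.+2.
    apply: le_lt_trans zs1 _.
    have: forall j, (j <= i)%N -> s 1%N < s j.+2.
      elim=> [|j IHj] ji; first by apply: mono; lia.
      have lt_j : (j.+2 < m.+1)%N by lia.
      exact: lt_trans (IHj (ltnW ji)) (mono _ lt_j).
    exact.
  have := sg i.+2 im; rewrite E hornerM hornerXsubC hornerN exprS.
  rewrite (_ : _ * _ = (s i.+2 - z) * ((-1) ^+ i.+1 * - q.[s i.+2])); last by ring.
  by rewrite pmulr_rge0 // subr_gt0.
exists (- c), (fun i => if i is j.+1 then t j else z); split.
  rewrite rpSl E -[q]opprK Eq scaleNr mulrN.
  by rewrite -scalerAr.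
by case=> [|i] im //; apply: H.
Qed.

(** The two outer roots come from adding to [s] a point far to the left and a
    point far to the right, where the sign is that of the leading term. *)
Lemma interlacing_roots n Q s : size Q = n.+2 -> 0 < lead_coef Q ->
  (forall i, (i.+1 < n)%N -> s i < s i.+1) ->
  (forall i, (i < n)%N -> 0 <= (-1) ^+ (n + i) * Q.[s i]) ->
  exists t, Q = lead_coef Q *: rp n.+1 t /\
    forall i, (i < n)%N -> t i <= s i /\ s i <= t i.+1.
Proof.
move=> sz lc mono sg.
have [N1 HN1] := poly_pinfty_gt_lc lc.
have lc2 : 0 < lead_coef ((-1) ^+ n.+1 *: (Q \Po (- 'X))).
  rewrite lead_coefZ lead_coef_comp ?size_polyN ?size_polyX // lead_coefN lead_coefX.
  by rewrite sz mulrCA -exprMn mulrNN mulr1 expr1n mulr1.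
have [N2 HN2] := poly_pinfty_gt_lc lc2.
(* The summand [1] keeps the outer points strictly outside the points [s], and
   apart from each other when [n = 0]. *)
pose hi : R := `|N1| + `|s n.-1| + 1; pose lo : R := `|N2| + `|s 0%N| + 1.
pose u i := if i is j.+1 then (if (j < n)%N then s j else hi) else - lo.
have lohi : - lo < hi.
  rewrite /lo /hi.
  have := (normr_ge0 N1, normr_ge0 N2, normr_ge0 (s n.-1), normr_ge0 (s 0%N)).
  by move=> [[[]]]; lra.
have [||| c [t [E H]]] := @alternating_roots n.+1 ((-1) ^+ n.+1 *: Q) u.
- by rewrite size_scale ?signr_eq0 // sz.
- case=> [|i] /= in_.
    case: ifP => _ //; rewrite /lo; have := (normr_ge0 N2, lerNnormlW (lexx `|s 0%N|)).
    by move=> []; lra.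
  rewrite -ltnS in_; case: ifP => [i1n|i1n]; first exact: mono.
  have -> : i = n.-1 by lia.
  by rewrite /hi; have := (normr_ge0 N1, ler_norm (s n.-1)); move=> []; lra.
- case=> [|i] /= in_; rewrite hornerZ.
    have := HN2 lo; rewrite hornerZ horner_comp hornerN hornerX mul1r => h.
    apply: le_trans (ltW lc2) (h _); rewrite /lo.
    by have := (ler_norm N2, normr_ge0 (s 0%N)); move=> []; lra.
  rewrite mulrA -exprD; case: ifP => i1n.
    have -> : (i.+1 + n.+1 = n + i + 2)%N by lia.
    by rewrite exprD sqrrN expr1n mulr1 sg.
  have -> : i = n by lia.
  rewrite -signr_odd addnn odd_double mul1r.
  apply: le_trans (ltW lc) (HN1 _ _); rewrite /hi.
  by have := (ler_norm N1, normr_ge0 (s n.-1)); move=> []; lra.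
have EQ : Q = ((-1) ^+ n.+1 * c) *: rp n.+1 t.
  by rewrite -scalerA -E scalerA -exprD -signr_odd addnn odd_double scale1r.
exists t; split.
  by rewrite {2}EQ lead_coefZ (monicP (monic_rp _ _)) mulr1.
move=> i i_n; split; first by have [_] := H i (ltnW i_n); rewrite /= i_n.
by have [+ _] := H i.+1 i_n; rewrite /= i_n.
Qed.

End RealRootedPolynomials.

(** * Algebra of the finite difference convolution *)

Section Conv.
Variables (R : realType) (b : R).
Hypothesis b_gt0 : 0 < b.
Implicit Types (p q r : {poly R}) (a c t : nat -> R) (n m k : nat).

Local Notation D := (fdiff b).
Local Notation sh p := (p \Po ('X - b%:P)).
Local Notation conv := (fdconv b).

Let b_neq0 : b != 0. Proof. by rewrite gt_eqF. Qed.

Lemma fdiffD p q : D (p + q) = D p + D q.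
Proof. by rewrite /fdiff comp_polyD -scalerDr; congr (_ *: _); ring. Qed.

Lemma fdiffZ x p : D (x *: p) = x *: D p.
Proof. by rewrite /fdiff comp_polyZ -scalerBr !scalerA [_ * x]mulrC. Qed.

Lemma fdiff0 : D 0 = 0.
Proof. by have := fdiffZ 0 0; rewrite !scale0r. Qed.

Lemma fdiffB p q : D (p - q) = D p - D q.
Proof. by rewrite -scaleN1r fdiffD fdiffZ scaleN1r. Qed.

Lemma fdiff_sum (I : Type) (s : seq I) (F : I -> {poly R}) :
  D (\sum_(i <- s) F i) = \sum_(i <- s) D (F i).
Proof. exact: (big_morph D fdiffD fdiff0). Qed.

Lemma iter_fdiffD k p q : iter k D (p + q) = iter k D p + iter k D q.
Proof. by elim: k => //= k ->; rewrite fdiffD. Qed.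

Lemma iter_fdiffZ k x p : iter k D (x *: p) = x *: iter k D p.
Proof. by elim: k => //= k ->; rewrite fdiffZ. Qed.

Lemma iter_fdiffB k p q : iter k D (p - q) = iter k D p - iter k D q.
Proof. by elim: k => //= k ->; rewrite fdiffB. Qed.

Lemma shiftE p : sh p = p - b *: D p.
Proof. by rewrite /fdiff scalerA divff // scale1r; ring. Qed.

Lemma horner_shift p x : (sh p).[x] = p.[x - b].
Proof. by rewrite horner_comp hornerXsubC. Qed.

Lemma fdiff_shift p : D (sh p) = sh (D p).
Proof. by rewrite !shiftE fdiffB fdiffZ. Qed.

Lemma iter_fdiff_shift k p : iter k D (sh p) = sh (iter k D p).
Proof. by rewrite !shiftE iter_fdiffB iter_fdiffZ -iterSr. Qed.

Lemma fdiff_mulX q : D ('X * q) = 'X * D q + sh q.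
Proof.
apply: (scalerI b_neq0); rewrite scalerDr -scalerAr.
rewrite /fdiff !scalerA divff // !scale1r comp_polyM comp_polyX -mul_polyC.
by ring.
Qed.

Lemma size_fdiff p : (size (D p) <= (size p).-1)%N.
Proof.
elim/poly_ind: p => [|q c IH]; first by rewrite fdiff0 size_poly0.
have Dc : D c%:P = 0 by rewrite /fdiff comp_polyC subrr scaler0.
rewrite fdiffD Dc addr0 mulrC fdiff_mulX.
have [->|q0] := eqVneq q 0.
  by rewrite fdiff0 comp_poly0 mulr0 addr0 size_poly0.
rewrite mulrC size_MXaddC (negPf q0) /=.
apply: leq_trans (size_polyD _ _) _; 
rewrite geq_max size_comp_poly2 ?size_XsubC // leqnn andbT.
have [->|Dq0] := eqVneq (D q) 0; first by rewrite mulr0 size_poly0.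
rewrite mulrC size_mulX //.
by move: q0; rewrite -size_poly_gt0 => q0; rewrite -(prednK q0) ltnS.
Qed.

Lemma size_iter_fdiff k p : (size (iter k D p) <= size p - k)%N.
Proof.
elim: k => [|k IH]; first by rewrite subn0.
by rewrite iterS; apply: leq_trans (size_fdiff _) _; lia.
Qed.

Lemma iter_fdiff_eq0 k p : (size p <= k)%N -> iter k D p = 0.
Proof.
move=> szp; apply/eqP; rewrite -size_poly_leq0.
by apply: leq_trans (size_iter_fdiff _ _) _; rewrite leqn0 subn_eq0.
Qed.

(** A polynomial with zero difference is [b]-periodic, hence takes its value at
    [0] infinitely often. *)
Lemma fdiff_eq0 p : D p = 0 -> p.[0] = 0 -> p = 0.
Proof.
move=> Dp p0.
have per x : p.[x - b] = p.[x] by rewrite -horner_shift shiftE Dp scaler0 subr0.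
have rt k : p.[- (b *+ k)] = 0.
  by elim: k => [|k IH]; rewrite ?mulr0n ?oppr0 // mulrS opprD addrC per.
apply/eqP/contraT => pn0.
have := @max_poly_roots R p (mkseq (fun k => - (b *+ k)) (size p)) pn0.
rewrite size_mkseq ltnn => -> //.
  by apply/allP => x /mapP[k _ ->]; apply/rootP.
rewrite mkseq_uniq // => i j /oppr_inj /eqP.
by rewrite -[b *+ i]mulr_natr -[b *+ j]mulr_natr (inj_eq (mulfI b_neq0)) eqr_nat => /eqP.
Qed.

Lemma fdconvZl n x p r : conv n (x *: p) r = x *: conv n p r.
Proof.
rewrite /fdconv scaler_sumr; apply: eq_bigr => k _.
by rewrite iter_fdiffZ !scalerA mulrC.
Qed.

Lemma fdconvBl n p q r : conv n (p - q) r = conv n p r - conv n q r.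
Proof.
rewrite /fdconv -sumrB; apply: eq_bigr => k _.
by rewrite iter_fdiffB scalerBr.
Qed.

Lemma fdconvZr n x p r : conv n p (x *: r) = x *: conv n p r.
Proof.
rewrite /fdconv scaler_sumr; apply: eq_bigr => k _.
by rewrite iter_fdiffZ hornerZ scalerA.
Qed.

Lemma fdconvDr n p r q : conv n p (r + q) = conv n p r + conv n p q.
Proof.
rewrite /fdconv -big_split; apply: eq_bigr => k _.
by rewrite iter_fdiffD hornerD scalerDl.
Qed.

Lemma fdconvNr n p r : conv n p (- r) = - conv n p r.
Proof. by rewrite -scaleN1r fdconvZr scaleN1r. Qed.

Lemma fdconv_sumr n m p (F : 'I_m -> {poly R}) :
  conv n p (\sum_(i < m) F i) = \sum_(i < m) conv n p (F i).
Proof.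
apply: (big_morph (conv n p) (fun x y => fdconvDr n p x y)).
by rewrite -[0](scale0r 0) fdconvZr !scale0r.
Qed.

Lemma fdiff_fdconv n p r : D (conv n p r) = conv n (D p) r.
Proof.
by rewrite /fdconv fdiff_sum; apply: eq_bigr => k _; rewrite fdiffZ -iterSr.
Qed.

Lemma fdconv_shift n p r : conv n (sh p) r = sh (conv n p r).
Proof. by rewrite !shiftE fdconvBl fdconvZl fdiff_fdconv. Qed.

Lemma size_fdconv n p r : (size (conv n p r) <= size p)%N.
Proof.
apply: leq_trans (size_sum _ _ _) _; apply/bigmax_leqP => k _.
apply: leq_trans (size_scale_leq _ _) _.
by apply: leq_trans (size_iter_fdiff _ _) (leq_subr _ _).
Qed.

Lemma fdconvS n p r : (size p <= n.+1)%N -> conv n.+1 p r = conv n p (D r).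
Proof.
move=> szp; rewrite /fdconv big_ord_recr /= (iter_fdiff_eq0 szp : D (iter n D p) = 0).
rewrite scaler0 addr0; apply: eq_bigr => k _.
by rewrite -iterSr subSn // -ltnS.
Qed.

Lemma horner0_fdconv n p r :
  (conv n p r).[0] = \sum_(k < n.+1) (iter (n - k) D r).[0] * (iter k D p).[0].
Proof. by rewrite horner_sum; apply: eq_bigr => k _; rewrite hornerZ. Qed.

(** Both sides agree at [0] by reversing the sum, and their differences agree by
    induction on [n], since a difference can be moved into either factor. *)
Lemma fdconvC n p r : (size p <= n.+1)%N -> (size r <= n.+1)%N ->
  conv n p r = conv n r p.
Proof.
elim: n p r => [|n IH] p r szp szr.
  rewrite [p]size1_polyC // [r]size1_polyC // /fdconv !big_ord1 /=.
  by rewrite !hornerC -!mul_polyC -!polyCM mulrC.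
apply/eqP; rewrite -subr_eq0; apply/eqP/fdiff_eq0.
  have szD q : (size q <= n.+2)%N -> (size (D q) <= n.+1)%N.
    by move=> szq; apply: leq_trans (size_fdiff q) _; lia.
  by rewrite fdiffB !fdiff_fdconv !fdconvS ?szD // IH ?szD // subrr.
rewrite hornerD hornerN !horner0_fdconv -(big_mkord xpredT
  (fun k => (iter (n.+1 - k) D r).[0] * (iter k D p).[0])) big_nat_rev big_mkord.
apply/eqP; rewrite subr_eq0; apply/eqP; apply: eq_bigr => k _.
by rewrite mulrC; congr ((iter _ D _).[0] * (iter _ D _).[0]); have := ltn_ord k; lia.
Qed.

Lemma iter_fdiff_mulX k q :
  iter k D ('X * D q) = 'X * iter k.+1 D q + k%:R *: sh (iter k D q).
Proof.
elim: k => [|k IH]; first by rewrite scale0r addr0.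
rewrite iterS IH fdiffD fdiff_mulX (fdiffZ k%:R).
rewrite fdiff_shift -addrA; congr (_ + _).
by rewrite -[X in X + _]scale1r -scalerDl -natr1 [1 + _]addrC.
Qed.

Lemma iter_fdiffS_mulX k q :
  iter k.+1 D ('X * q) = 'X * iter k.+1 D q + k.+1%:R *: sh (iter k D q).
Proof.
rewrite iterSr fdiff_mulX iter_fdiffD iter_fdiff_mulX iter_fdiff_shift -addrA.
by rewrite -[X in _ + (_ + X)]scale1r -scalerDl natr1.
Qed.

(** The product rule for differences adds to the [k]-th summand a term with
    factor [k] and a shifted iterated difference of [q].  Both the factor and
    the shift can be transferred to [r]: by the same rule, the iterated
    differences at [0] of the last argument produce the same terms after an
    index shift in the sum. *)
Lemma fdconv_mulX n q r : (size q <= n.+1)%N ->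
  conv n.+1 ('X * q) r = 'X * conv n.+1 q r +
    conv n q (n.+1%:R *: sh r - ('X - b%:P) * D r).
Proof.
move=> szq; pose v m := (iter m D r).[0]; pose Q j := iter j D q.
have vr m : (iter m D (n.+1%:R *: sh r - ('X - b%:P) * D r)).[0] =
    (n.+1%:R - m%:R) * v m - b * (n%:R - m%:R) * v m.+1.
  rewrite mulrBl mul_polyC !iter_fdiffB (iter_fdiffZ m n.+1%:R) (iter_fdiffZ m b).
  rewrite iter_fdiff_mulX -iterSr.
  rewrite iter_fdiff_shift shiftE -[D (iter m D r)]/(iter m.+1 D r) /v.
  move: (iter m D r) (iter m.+1 D r) => f g; rewrite !hornerE -natr1.
  by ring.
have lhs : conv n.+1 ('X * q) r = 'X * conv n.+1 q r +
    \sum_(j < n.+1) (v (n - j)%N * j.+1%:R) *: (Q j - b *: Q j.+1).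
  rewrite /fdconv big_ord_recl [in RHS]big_ord_recl /= mulrDr -!addrA -scalerAr.
  congr (_ + _); rewrite mulr_sumr -big_split /=; apply: eq_bigr => j _.
  rewrite /bump leq0n add1n -!iterS iter_fdiffS_mulX scalerDr scalerA shiftE.
  by rewrite add0n subSS -[in RHS]scalerAr.
rewrite lhs; congr (_ + _); rewrite /fdconv.
have split_l : \sum_(j < n.+1) (v (n - j)%N * j.+1%:R) *: (Q j - b *: Q j.+1) =
    \sum_(j < n.+1) (v (n - j)%N * j.+1%:R) *: Q j
    - b *: \sum_(j < n) (v (n - j)%N * j.+1%:R) *: Q j.+1.
  under eq_bigr do rewrite scalerBr.
  rewrite sumrB; congr (_ - _).
  (* The top difference of [q] vanishes, which allows an index shift. *)
  have Qn : Q n.+1 = 0 by exact: iter_fdiff_eq0.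
  rewrite big_ord_recr /= [D (Q n)]Qn !scaler0 addr0 scaler_sumr.
  by apply: eq_bigr => j _; rewrite !scalerA [b * _]mulrC.
have split_r : \sum_(j < n.+1) (iter (n - j) D (n.+1%:R *: sh r - ('X - b%:P) * D r)).[0]
      *: Q j =
    \sum_(j < n.+1) (v (n - j)%N * j.+1%:R) *: Q j
    - b *: \sum_(j < n) (v (n - j)%N * j.+1%:R) *: Q j.+1.
  have e (j : 'I_n.+1) : (iter (n - j) D (n.+1%:R *: sh r - ('X - b%:P) * D r)).[0] *: Q j
      = (v (n - j)%N * j.+1%:R) *: Q j - b *: ((v (n - j).+1 * j%:R) *: Q j).
    rewrite vr scalerA -scalerBl; congr (_ *: _).
    have jn : (j <= n)%N by rewrite -ltnS.
    by rewrite natrB // -!natr1; ring.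
  under eq_bigr do rewrite e.
  rewrite sumrB; congr (_ - _); rewrite -scaler_sumr; congr (_ *: _).
  rewrite big_ord_recl mulr0 scale0r add0r; apply: eq_bigr => j _.
  by rewrite lift0 subnSK.
by rewrite split_l split_r.
Qed.

End Conv.

(** * Decomposing the difference of a polynomial with given roots *)

(** The roots of [g_j], the common factor of two consecutive polynomials in the
    process that moves the roots [c_0, c_1, ...] to the right by [b], in this
    order: [c_j] is deleted, and the roots before it have already moved. *)
Definition gapseq (R : realType) (b : R) (c : nat -> R) (j i : nat) : R :=
  if (i < j)%N then c i + b else c i.+1.

Section FirstDifference.
Variables (R : realType) (b : R).
Hypothesis b_gt0 : 0 < b.
Implicit Types (p q r : {poly R}) (a c t : nat -> R) (n m k : nat).

Local Notation D := (fdiff b).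
Local Notation sh p := (p \Po ('X - b%:P)).
Local Notation conv := (fdconv b).

Let b_neq0 : b != 0. Proof. by rewrite gt_eqF. Qed.

Lemma shift_rp n c : sh (rp n c) = rp n (fun i => c i + b).
Proof.
elim: n => [|n IH]; first by rewrite !rp0 comp_polyC.
rewrite !rpSr comp_polyM IH; congr (_ * _).
by rewrite comp_polyB comp_polyX comp_polyC polyCD opprD addrAC addrA.
Qed.

Lemma partial_shift n c j : (j <= n)%N ->
  rp n.+1 (fun i => if (i < j)%N then c i + b else c i) =
    ('X - (c j)%:P) * rp n (gapseq b c j).
Proof.
move=> jn; rewrite (rp_del _ jn) ltnn; congr (_ * _); apply: eq_rp => i _.
rewrite /bump /gapseq; case: (ltnP i j) => ij; first by rewrite add0n ij.
by rewrite ifF //; lia.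
Qed.

Lemma partial_shiftS n c j : (j <= n)%N ->
  rp n.+1 (fun i => if (i < j.+1)%N then c i + b else c i) =
    ('X - (c j + b)%:P) * rp n (gapseq b c j).
Proof.
move=> jn; rewrite (rp_del _ jn) ltnSn; congr (_ * _); apply: eq_rp => i _.
rewrite /bump /gapseq; case: (ltnP i j) => ij; first by rewrite add0n ltnS ltnW.
by rewrite ifF //; lia.
Qed.

(** The sum telescopes along the partial shifts of the roots, which lead from the
    polynomial to its translate; two consecutive ones differ by [b] times a
    common factor. *)
Lemma fdiff_rp n c : D (rp n.+1 c) = \sum_(j < n.+1) rp n (gapseq b c j).
Proof.
pose h j := rp n.+1 (fun i => if (i < j)%N then c i + b else c i).
have h0 : h 0%N = rp n.+1 c by [].
have hn : h n.+1 = sh (rp n.+1 c).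
  by rewrite shift_rp; apply: eq_rp => i ->.
apply: (scalerI b_neq0); rewrite /fdiff scalerA divff // scale1r -hn -h0.
rewrite scaler_sumr -opprB -(telescope_sumr _ (leq0n n.+1)) big_mkord -sumrN.
apply: eq_bigr => j _; have jn : (j <= n)%N by rewrite -ltnS.
rewrite /h (partial_shift c jn) (partial_shiftS c jn) -mul_polyC polyCD.
by ring.
Qed.

(** The weights [c_j + b j] make a second sum telescope: with [h_j] the partial
    shifts, [(X - b - c_j - b j) g_j = h_(j+1) - j (h_j - h_(j+1))]. *)
Lemma weighted_fdiff_rp n c :
  ('X - b%:P) * D (rp n.+1 c) - n.+1%:R *: sh (rp n.+1 c) =
    \sum_(j < n.+1) (c j + b * j%:R) *: rp n (gapseq b c j).
Proof.
pose h j := rp n.+1 (fun i => if (i < j)%N then c i + b else c i).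
have hn : h n.+1 = sh (rp n.+1 c).
  by rewrite shift_rp; apply: eq_rp => i ->.
rewrite -hn fdiff_rp mulr_sumr.
have -> : n.+1%:R *: h n.+1 = \sum_(j < n.+1) (j.+1%:R *: h j.+1 - j%:R *: h j).
  rewrite -(big_mkord xpredT (fun j => j.+1%:R *: h j.+1 - j%:R *: h j)).
  by rewrite (telescope_sumr (fun j => j%:R *: h j)) // scale0r subr0.
rewrite -sumrB; apply: eq_bigr => j _; have jn : (j <= n)%N by rewrite -ltnS.
rewrite /h (partial_shift c jn) (partial_shiftS c jn) -!mul_polyC -natr1 !polyCD polyCM.
by ring.
Qed.

Lemma fdconv_mulXsubC n al q c : (size q <= n.+1)%N ->
  conv n.+1 (('X - al%:P) * q) (rp n.+1 c) =
    ('X - al%:P) * conv n q (D (rp n.+1 c))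
    - \sum_(j < n.+1) (c j + b * j%:R) *: conv n q (rp n (gapseq b c j)).
Proof.
move=> szq; rewrite mulrBl mul_polyC fdconvBl fdconvZl fdconv_mulX // fdconvS //.
have -> : \sum_(j < n.+1) (c j + b * j%:R) *: conv n q (rp n (gapseq b c j)) =
    conv n q (('X - b%:P) * D (rp n.+1 c) - n.+1%:R *: sh (rp n.+1 c)).
  rewrite weighted_fdiff_rp fdconv_sumr; apply: eq_bigr => j _.
  by rewrite fdconvZr.
have -> : conv n q (n.+1%:R *: sh (rp n.+1 c) - ('X - b%:P) * D (rp n.+1 c)) =
    - conv n q (('X - b%:P) * D (rp n.+1 c) - n.+1%:R *: sh (rp n.+1 c)).
  by rewrite -fdconvNr opprB.
by rewrite [in RHS]mulrBl mul_polyC addrAC.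
Qed.

Lemma spaced_gapseq n c j : spaced b n.+1 c -> spaced b n (gapseq b c j).
Proof.
move=> sc i i_n; rewrite /gapseq.
have := sc i (ltnW i_n); have := sc i.+1 i_n; have := b_gt0.
case: (ltnP i j); case: (ltnP i.+1 j) => //; try lia; lra.
Qed.

(** The signs of the difference at the points [c_i + b], where only the first
    value counts, and at the points [c_i], where only the second counts, both
    alternate.  The two resulting root vectors coincide, and each yields one of
    the two bounds. *)
Lemma fdiff_rp_roots n c : spaced b n.+1 c ->
  exists u, D (rp n.+1 c) = n.+1%:R *: rp n u /\
    forall i, (i < n)%N -> c i + b <= u i /\ u i <= c i.+1.
Proof.
move=> sc; set d := D _.
have szd : (size d <= n.+1)%N by apply: leq_trans (size_fdiff b_gt0 _) _; rewrite size_rp.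
have cle i j : (i <= j < n.+1)%N -> c i <= c j by apply: spaced_le (ltW b_gt0) sc.
have clt i j : (i < j < n.+1)%N -> c i + b <= c j by apply: spaced_lt b_gt0 sc.
have lcd : d`_n = n.+1%:R.
  rewrite /d fdiff_rp coef_sum (eq_bigr (fun=> 1)) ?sumr_const ?card_ord // => j _.
  by have := monicP (monic_rp n (gapseq b c j)); rewrite lead_coefE size_rp.
have szQ : (size ((-1) ^+ n *: d) <= n.+1)%N by rewrite size_scale ?signr_eq0.
have finish s : (forall i, (i < n)%N -> s i < s i.+1) ->
    (forall i, (i <= n)%N -> 0 <= (-1) ^+ i * ((-1) ^+ n *: d).[s i]) ->
    exists u, d = n.+1%:R *: rp n u /\ forall i, (i < n)%N -> s i <= u i /\ u i <= s i.+1.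
  move=> mono sg; have [k [u [E H]]] := alternating_roots szQ mono sg.
  exists u; split => //.
  have Ed : d = ((-1) ^+ n * k) *: rp n u.
    by rewrite -scalerA -E scalerA -exprD -signr_odd addnn odd_double scale1r.
  rewrite {1}Ed; congr (_ *: _); rewrite -lcd Ed coefZ.
  by have := monicP (monic_rp n u); rewrite lead_coefE size_rp /= => ->; rewrite mulr1.
have mono i : (i < n)%N -> c i < c i.+1 by move=> i_n; have := sc i i_n; have := b_gt0; lra.
have [||u [Eu Hu]] := finish (fun i => c i + b).
- by move=> i i_n; rewrite ltrD2r mono.
- move=> i i_n; rewrite hornerZ mulrA -exprD horner_fdiff addrK.
  have -> : (rp n.+1 c).[c i] = 0.
    by rewrite (rp_del _ i_n) hornerM hornerXsubC subrr mul0r.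
  rewrite subr0 mulrA divr_ge0 ?(ltW b_gt0) //.
  have -> : (-1) ^+ (i + n) = (-1) ^+ (n.+1 + i.+1) :> R.
    by rewrite (_ : (n.+1 + i.+1) = (i + n) + 2)%N ?exprD ?sqrrN ?expr1n ?mulr1 //; lia.
  apply: rp_sign => // k ki.
    by apply: le_trans (cle k i _) _; rewrite ?lerDl ?(ltW b_gt0) //; lia.
  by apply: clt; lia.
have [|u' [Eu' Hu']] := finish c mono.
- move=> i i_n; rewrite hornerZ mulrA -exprD horner_fdiff.
  have -> : (rp n.+1 c).[c i] = 0.
    by rewrite (rp_del _ i_n) hornerM hornerXsubC subrr mul0r.
  rewrite sub0r mulrA divr_ge0 ?(ltW b_gt0) // mulrN -mulNr -mulN1r -exprS.
  have -> : (-1) ^+ (i + n).+1 = (-1) ^+ (n.+1 + i) :> R.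
    by congr (_ ^+ _); lia.
  apply: rp_sign => //; first exact: leqW.
    by move=> k ki; rewrite lerBrDr clt //; lia.
  by move=> k ki; rewrite lerBlDr; have := cle i k ki; have := b_gt0; lra.
have srt (v s : nat -> R) :
    (forall i, (i < n)%N -> s i <= v i /\ v i <= s i.+1) -> spaced 0 n v.
  by move=> H i i_n; rewrite addr0; have [_ h1] := H i (ltnW i_n);
    have [h2 _] := H _ i_n;
    apply: le_trans h1 h2.
have Eru : rp n u = rp n u'.
  have: n.+1%:R *: rp n u = n.+1%:R *: rp n u' by rewrite -Eu.
  by apply: scalerI; rewrite pnatr_eq0.
exists u; split => // i i_n; split; first by have [] := Hu i i_n.
rewrite (sorted_rp_inj (srt u (fun i => c i + b) Hu) (srt u' c Hu') Eru i_n).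
by have [] := Hu' i i_n.
Qed.

End FirstDifference.

(** * Roots of the convolution *)

Definition conv_roots (R : realType) (b : R) n (a c t : nat -> R) : Prop :=
  exists2 k, 0 < k & fdconv b n (rp n a) (rp n c) = k *: rp n t.

(** The last two laws assume [t] and [t'] to be sorted but not to have gaps at
    least [b]: in each degree, the gaps in the first law are derived from the
    third one. *)
Definition conv_interlacing_laws (R : realType) (b : R) n : Prop :=
  [/\ forall a c, spaced b n a -> spaced b n c ->
        exists2 t, spaced b n t & conv_roots b n a c t,
      forall a a' c t t', spaced b n a -> spaced b n a' -> spaced b n c ->
        spaced 0 n t -> spaced 0 n t' ->
        conv_roots b n a c t -> conv_roots b n a' c t' ->
        (forall i, (i < n)%N -> a i <= a' i) ->
        forall i, (i < n)%N -> t i <= t' i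
    & forall a a' c t t', spaced b n a -> spaced b n a' -> spaced b n c ->
        spaced 0 n t -> spaced 0 n t' ->
        conv_roots b n a c t -> conv_roots b n a' c t' ->
        (forall i, (i.+1 < n)%N -> a' i <= a i.+1) ->
        forall i, (i.+1 < n)%N -> t' i <= t i.+1].

Section Induction.
Variables (R : realType) (b : R).
Hypothesis b_gt0 : 0 < b.
Implicit Types (p q r : {poly R}) (a c t u v w : nat -> R) (n m k : nat).

Local Notation D := (fdiff b).
Local Notation conv := (fdconv b).

Lemma scaled_rp_inj n (k k' : R) s t : spaced 0 n s -> spaced 0 n t -> 0 < k ->
  k *: rp n s = k' *: rp n t -> forall i, (i < n)%N -> s i = t i.
Proof.
move=> ss st k0 E; apply: sorted_rp_inj => //.
have := congr1 lead_coef E; rewrite !lead_coefZ !(monicP (monic_rp _ _)) !mulr1 => kk.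
by move: E; rewrite -kk; apply: scalerI; rewrite gt_eqF.
Qed.

Lemma conv_roots_inj n a c s t : spaced 0 n s -> spaced 0 n t ->
  conv_roots b n a c s -> conv_roots b n a c t -> forall i, (i < n)%N -> s i = t i.
Proof.
move=> ss st [k k0 E] [k' _ E']; apply: (scaled_rp_inj (k' := k') ss st k0).
by rewrite -E.
Qed.

Lemma eq_conv_roots n a a' c t : (forall i, (i < n)%N -> a i = a' i) ->
  conv_roots b n a c t -> conv_roots b n a' c t.
Proof. by move=> aa' [k k0 E]; exists k => //; rewrite -(eq_rp aa'). Qed.

Lemma conv_rootsC n a c t : conv_roots b n a c t -> conv_roots b n c a t.
Proof. by move=> [k k0 E]; exists k => //; rewrite fdconvC ?size_rp. Qed.

Lemma spaced_sorted n t : spaced b n t -> spaced 0 n t.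
Proof. by move=> st i i_n; have := st i i_n; have := b_gt0; lra. Qed.

Lemma spaced_bump n k a : spaced b n.+1 a -> spaced b n (fun i => a (bump k i)).
Proof.
by move=> sa i i_n; apply: (spaced_lt b_gt0 sa); rewrite /bump; lia.
Qed.

Lemma interlacing_sorted n t s :
  (forall i, (i < n)%N -> t i <= s i /\ s i <= t i.+1) -> spaced 0 n.+1 t.
Proof.
by move=> H i i_n; rewrite addr0; have [h1 h2] := H i i_n; apply: le_trans h1 h2.
Qed.

(** Subtracting from all weights the one at the sign change of [v] leaves the
    weighted sum unchanged and makes every term nonnegative. *)
Lemma increasing_weights m v w :
  (forall i j, (i <= j < m)%N -> w i <= w j) ->
  (forall i j, (i <= j < m)%N -> 0 < v i -> 0 <= v j) ->
  \sum_(j < m) v j = 0 -> 0 <= \sum_(j < m) w j * v j.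
Proof.
move=> mw sv sum0.
suff [x H] : exists x, forall j, (j < m)%N -> 0 <= (w j - x) * v j.
  have -> : \sum_(j < m) w j * v j = \sum_(j < m) (w j - x) * v j.
    have e0 : x * \sum_(j < m) v j = 0 by rewrite sum0 mulr0.
    under [RHS]eq_bigr do rewrite mulrBl.
    by rewrite sumrB -mulr_sumr e0 subr0.
  by apply: sumr_ge0 => j _; apply: H.
have [ex|nex] := boolP [exists j : 'I_m, 0 < v j].
  have ex' : exists j, (j < m)%N && (0 < v j).
    by have [j vj] := existsP ex; exists j; rewrite ltn_ord.
  case: (ex_minnP ex') => j0 /andP[j0m vj0] min.
  exists (w j0) => j jm; have [jj0|j0j] := ltnP j j0.
    have vj : v j <= 0.
      by rewrite leNgt; apply: contraL jj0 => vj; rewrite -leqNgt min // jm.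
    by rewrite mulr_le0 // subr_le0 mw // (ltnW jj0).
  by rewrite mulr_ge0 ?subr_ge0 ?mw ?(sv j0) // ?j0j.
exists (w m.-1) => j jm; rewrite mulr_le0 //.
  by rewrite subr_le0 mw //; lia.
by rewrite leNgt; apply: contra nex => vj; apply/existsP; exists (Ordinal jm).
Qed.

(** If [t' i < t i], then at a point [y] between them the interlacing with [s]
    fixes the signs of all three polynomials, and these contradict the
    relation. *)
Lemma common_interlacing_le n (k k' kd x : R) t t' s :
  0 < k -> 0 < k' -> 0 < kd -> 0 <= x ->
  k *: rp n.+1 t - k' *: rp n.+1 t' = x *: (kd *: rp n s) ->
  (forall i, (i < n)%N -> t i <= s i /\ s i <= t i.+1) ->
  (forall i, (i < n)%N -> t' i <= s i /\ s i <= t' i.+1) ->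
  forall i, (i < n.+1)%N -> t i <= t' i.
Proof.
move=> k0 k'0 kd0 x0 E H H' i i_n; rewrite leNgt; apply/negP => lt_i.
have st := interlacing_sorted H; have st' := interlacing_sorted H'.
have mt l j : (l <= j < n.+1)%N -> t l <= t j by apply: spaced_le st.
have mt' l j : (l <= j < n.+1)%N -> t' l <= t' j by apply: spaced_le st'.
pose y := (t' i + t i) / 2.
have [y1 y2] : t' i < y /\ y < t i by rewrite /y; split; lra.
have F0 : 0 < (-1) ^+ (n.+1 + i) * (rp n.+1 t).[y].
  apply: rp_sign_lt => [|l li|l /andP[il ln]]; first exact: ltnW.
    have [h1 _] := H l (leq_trans li i_n); have [_ h2] := H' l (leq_trans li i_n).
    by have := mt' l.+1 i; rewrite li i_n => /(_ isT); lra.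
  by have := mt i l; rewrite il ln => /(_ isT); lra.
have G0 : 0 < (-1) ^+ (n.+1 + i.+1) * (rp n.+1 t').[y].
  apply: rp_sign_lt => // [l li|[//|l] /andP[il ln]].
    by have := mt' l i; rewrite -ltnS li i_n => /(_ isT); lra.
  have [h1 _] := H l ln; have [_ h2] := H' l ln.
  by have := mt i l; rewrite -ltnS il ltnW // => /(_ isT); lra.
have Q0 : 0 < (-1) ^+ (n + i) * (rp n s).[y].
  apply: rp_sign_lt => // l.
    move=> li; have [_ h2] := H' l (leq_trans li i_n).
    by have := mt' l.+1 i; rewrite li i_n => /(_ isT); lra.
  move=> /andP[il ln]; have [h1 _] := H l ln.
  by have := mt i l; rewrite il ltnW // => /(_ isT); lra.
have := congr1 (fun p => (-1) ^+ (n + i) * p.[y]) E.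
rewrite /= hornerD hornerN !hornerZ; move: F0 G0 Q0; rewrite addnS !addSn !exprS.
set e := (-1) ^+ (n + i); set f := (rp _ t).[y]; set g := (rp _ t').[y].
set q := (rp n s).[y] => F0 G0 Q0 eq.
have F1 : k * (e * f) < 0 by rewrite pmulr_rlt0 //; lra.
have G1 : 0 < k' * (e * g) by rewrite mulr_gt0 //; lra.
have Q1 : 0 <= x * (kd * (e * q)) by rewrite mulr_ge0 // mulr_ge0 // ltW.
by lra.
Qed.

(** The roots [s] do not depend on [al]; this is what makes the convolutions for
    different [al] comparable. *)
Lemma conv_interlacing n a c : conv_interlacing_laws b n ->
  spaced b n a -> spaced b n.+1 c ->
  exists s (kd : R), [/\ spaced b n s, 0 < kd,
    conv n (rp n a) (D (rp n.+1 c)) = kd *: rp n s &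
    forall al, exists t (k : R), [/\ 0 < k,
      conv n.+1 (('X - al%:P) * rp n a) (rp n.+1 c) = k *: rp n.+1 t &
      forall i, (i < n)%N -> t i <= s i /\ s i <= t i.+1]].
Proof.
move=> [exR monR ilR] sa sc; have [u [Du Hu]] := fdiff_rp_roots b_gt0 sc.
have bg := b_gt0.
have su : spaced b n u.
  move=> i i_n; have [_ h1] := Hu i (ltnW i_n); have [h2 _] := Hu _ i_n; lra.
have [s ss [k k0 Ek]] := exR a u sa su.
pose kd := n.+1%:R * k; have kd0 : 0 < kd by rewrite mulr_gt0 ?ltr0Sn.
have EA : conv n (rp n a) (D (rp n.+1 c)) = kd *: rp n s.
  by rewrite Du fdconvZr Ek scalerA.
exists s, kd; split => // al.
pose G j := conv n (rp n a) (rp n (gapseq b c j)).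
have sgap j : spaced b n (gapseq b c j) by exact: spaced_gapseq.
have cs i : (i < n)%N -> c i + b <= c i.+1 by move=> i_n; exact: sc.
(* By the third law, the roots of each [G j] interlace loosely with [s]: only
   the root of index [i] can lie on either side of [s i]. *)
have cross j : exists2 tj, spaced 0 n tj /\ conv_roots b n (gapseq b c j) a tj
    & (forall i, (i.+1 < n)%N -> tj i <= s i.+1) /\
      (forall i, (i.+1 < n)%N -> s i <= tj i.+1).
  have [tj stj rj] := exR a _ sa (sgap j).
  have rj' := conv_rootsC rj.
  have ru : conv_roots b n u a s by apply: conv_rootsC; exists k.
  exists tj; first by split => //; exact: spaced_sorted.
  split=> i i_n.
    apply: (ilR u (gapseq b c j) a s tj) => //; try exact: spaced_sorted.
    move=> l ln; have [h1 _] := Hu _ ln; have := cs l (ltnW ln).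
    by rewrite /gapseq; case: ifP => _; lra.
  apply: (ilR (gapseq b c j) u a tj s) => //; try exact: spaced_sorted.
  move=> l ln; have [_ h1] := Hu _ (ltnW ln); have := cs _ ln.
  by rewrite /gapseq; case: ifP => _; lra.
(* At [s i] the sign of [G j] tells on which side of [s i] its [i]-th root
   lies, and by the second law that root moves left as [j] increases. *)
have sgn i : (i < n)%N ->
    0 <= \sum_(j < n.+1) (c j + b * j%:R) * ((-1) ^+ (n + i).+1 * (G j).[s i]).
  move=> i_n.
  apply: (increasing_weights (w := fun j => c j + b * j%:R)
            (v := fun j => (-1) ^+ (n + i).+1 * (G j).[s i])).
  - move=> l j lj; apply: lerD; first by apply: spaced_le (ltW bg) sc _.
    by rewrite ler_pM2l // ler_nat; case/andP: lj.
  - move=> l j /andP[lj jn].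
    have [tl [stl rl] [up_l lo_l]] := cross l.
    have [tj [stj rj] [up_j lo_j]] := cross j.
    have le_jl : tj i <= tl i.
      apply: (monR _ _ _ _ _ (sgap j) (sgap l) sa stj stl rj rl) => // h hn.
      have := cs h hn; rewrite /gapseq.
      by case: (ltnP h j); case: (ltnP h l) => //; try lia; lra.
    have [kl kl0 El] := conv_rootsC rl; have [kj kj0 Ej] := conv_rootsC rj.
    rewrite /G El Ej !hornerZ => pos.
    have le_li : tl i <= s i.
      rewrite leNgt; apply/negP => lt_i.
      suff: 0 <= (-1) ^+ (n + i) * (rp n tl).[s i].
        move=> h; have := mulr_ge0 (ltW kl0) h; move: pos; rewrite exprS; lra.
      apply: rp_sign => [|h hi|h /andP[ih hn]]; first exact: ltnW.
        case: i i_n hi {pos lt_i le_jl} => // i i_n hi.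
        apply: le_trans (up_l i i_n); apply: spaced_le stl _ => //.
        by rewrite -ltnS hi ltnW.
      by apply: le_trans (ltW lt_i) _; apply: spaced_le stl _; rewrite // ih.
    rewrite mulrCA mulr_ge0 ?(ltW kj0) // -addnS.
    apply: rp_sign => // [h hi|h /andP[ih hn]].
      apply: le_trans le_li; apply: le_trans le_jl.
      by apply: spaced_le stj _ => //; rewrite -ltnS hi.
    apply: le_trans (lo_j i _) _; first by apply: leq_ltn_trans ih hn.
    by apply: spaced_le stj _ => //; rewrite ih.
  - by rewrite -mulr_sumr -horner_sum -fdconv_sumr -fdiff_rp // EA hornerZ
      horner_rp_root // !mulr0.
pose P := conv n.+1 (('X - al%:P) * rp n a) (rp n.+1 c).
have EP : P = ('X - al%:P) * (kd *: rp n s) - \sum_(j < n.+1) (c j + b * j%:R) *: G j.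
  by rewrite /P fdconv_mulXsubC ?size_rp // EA.
have szB : (size (\sum_(j < n.+1) (c j + b * j%:R) *: G j)%R <= n.+1)%N.
  apply: leq_trans (size_sum _ _ _) _; apply/bigmax_leqP => j _.
  apply: leq_trans (size_scale_leq _ _) _.
  by apply: leq_trans (size_fdconv b_gt0 _ _ _) _; rewrite size_rp.
have szM : size (('X - al%:P) * (kd *: rp n s)) = n.+2.
  by rewrite size_monicM ?monicXsubC ?scaler_eq0 ?gt_eqF ?monic_neq0 ?monic_rp //
    size_XsubC size_scale ?gt_eqF // size_rp.
have szP : size P = n.+2 by rewrite EP size_polyDl ?size_polyN szM.
have lcP : lead_coef P = kd.
  rewrite EP lead_coefDl ?size_polyN ?szM // lead_coefM lead_coefXsubC mul1r.
  by rewrite lead_coefZ (monicP (monic_rp _ _)) mulr1.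
have mono i : (i.+1 < n)%N -> s i < s i.+1 by move=> i_n; have := ss i i_n; lra.
have [||t [Et Ht]] := interlacing_roots szP _ mono; first by rewrite lcP.
  move=> i i_n; rewrite EP hornerD hornerN hornerM hornerZ horner_rp_root //.
  rewrite !mulr0 sub0r mulrN -mulNr -[- _]mulN1r -exprS horner_sum mulr_sumr.
  have := sgn i i_n; congr (0 <= _); apply: eq_bigr => j _.
  by rewrite hornerZ mulrCA.
by exists t, kd; split => //; rewrite -[LHS]/P Et lcP.
Qed.

End Induction.

(** * The induction on the degree *)

Section MainInduction.
Variables (R : realType) (b : R).
Hypothesis b_gt0 : 0 < b.
Implicit Types (p q r : {poly R}) (a c t u v w : nat -> R) (n m k : nat).

Local Notation D := (fdiff b).
Local Notation conv := (fdconv b).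

Lemma conv_interlacing_laws0 : conv_interlacing_laws b 0.
Proof.
split=> // a c _ _; exists (fun=> 0) => //; exists 1 => //.
by rewrite /fdconv big_ord1 /= !rp0 hornerC.
Qed.

Lemma conv_roots_exist n a c : conv_interlacing_laws b n ->
  spaced b n.+1 a -> spaced b n.+1 c ->
  exists2 t, spaced 0 n.+1 t & conv_roots b n.+1 a c t.
Proof.
move=> laws sa sc.
have sa' : spaced b n a by move=> i i_n; apply: sa; exact: ltnW.
have [s [kd [_ _ _ /(_ (a n)) [t [k [k0 E Ht]]]]]] := conv_interlacing b_gt0 laws sa' sc.
exists t; first exact: interlacing_sorted Ht.
by exists k => //; rewrite rpSr.
Qed.

(** Removing the moving root leaves a common factor [q] with gaps at least [b],
    so both convolutions are interlaced by the same polynomial. *)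
Lemma move_one_root n a a' c t t' k : conv_interlacing_laws b n ->
  spaced b n.+1 a -> spaced b n.+1 c -> spaced 0 n.+1 t -> spaced 0 n.+1 t' ->
  conv_roots b n.+1 a c t -> conv_roots b n.+1 a' c t' -> (k <= n)%N ->
  (forall i, i != k -> a i = a' i) -> a k <= a' k ->
  forall i, (i < n.+1)%N -> t i <= t' i.
Proof.
move=> laws sa sc st st' [k1 k10 E] [k2 k20 E'] kn aa' le_k i i_n.
have [s [kd [ss kd0 EA H]]] := conv_interlacing b_gt0 laws (spaced_bump b_gt0 k sa) sc.
pose q := rp n (fun i => a (bump k i)).
have ra : rp n.+1 a = ('X - (a k)%:P) * q by apply: rp_del.
have ra' : rp n.+1 a' = ('X - (a' k)%:P) * q.
  rewrite (rp_del _ kn); congr (_ * _); apply: eq_rp => j _.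
  by rewrite aa' // eq_sym neq_bump.
have [t1 [l1 [l10 E1 H1]]] := H (a k); have [t2 [l2 [l20 E2 H2]]] := H (a' k).
rewrite -/q -ra in E1; rewrite -/q -ra' in E2.
have -> : t i = t1 i.
  by apply: (scaled_rp_inj (k' := l1) st (interlacing_sorted H1) k10) => //; rewrite -E.
have -> : t' i = t2 i.
  by apply: (scaled_rp_inj (k' := l2) st' (interlacing_sorted H2) k20) => //; rewrite -E'.
apply: (common_interlacing_le (x := a' k - a k) l10 l20 kd0 _ _ H1 H2) => //.
  by rewrite subr_ge0.
rewrite -E1 -E2 -fdconvBl ra ra' -mulrBl -EA -fdconvS ?size_rp // -fdconvZl.
by congr (conv _ _ _); rewrite -mul_polyC polyCB /q; ring.
Qed.

(** The roots are raised one at a time, the largest first, which keeps all gaps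
    at least [b] on the way. *)
Lemma conv_roots_mono n a a' c t t' : conv_interlacing_laws b n ->
  spaced b n.+1 a -> spaced b n.+1 a' -> spaced b n.+1 c ->
  spaced 0 n.+1 t -> spaced 0 n.+1 t' ->
  conv_roots b n.+1 a c t -> conv_roots b n.+1 a' c t' ->
  (forall i, (i < n.+1)%N -> a i <= a' i) ->
  forall i, (i < n.+1)%N -> t i <= t' i.
Proof.
move=> laws sa sa' sc st st' ra ra' le_aa'.
pose h j i := if (i < j)%N then a i else a' i.
have sh j : spaced b n.+1 (h j).
  move=> i i_n; rewrite /h; have := sa i i_n; have := sa' i i_n; have := le_aa' _ i_n.
  by case: (ltnP i j); case: (ltnP i.+1 j) => //; try lia; lra.
suff H j : (j <= n.+1)%N -> forall s, spaced 0 n.+1 s -> conv_roots b n.+1 (h j) c s ->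
    forall i, (i < n.+1)%N -> s i <= t' i.
  by apply: (H n.+1) => //; apply: eq_conv_roots ra => i i_n; rewrite /h i_n.
elim: j => [|j IH] jn s ss rs i i_n.
  by rewrite (conv_roots_inj ss st' rs ra' i_n).
have [s' ss' rs'] := conv_roots_exist laws (sh j) sc.
apply: le_trans (IH (ltnW jn) s' ss' rs' i i_n).
apply: (move_one_root (k := j) laws (sh j.+1) sc ss ss' rs rs') => //.
  by move=> l lj; rewrite /h ltnS leq_eqVlt (negPf lj).
by rewrite /h ltnSn ltnn le_aa'.
Qed.

(** The vector [a'] lies below [a2 = (a_1, ..., a_n, N)] for a large [N], and [a2]
    arises from [a] by replacing its first root, so that the convolutions for
    [a] and [a2] are interlaced by one polynomial. *)
Lemma conv_roots_interlace n a a' c t t' : conv_interlacing_laws b n ->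
  spaced b n.+1 a -> spaced b n.+1 a' -> spaced b n.+1 c ->
  spaced 0 n.+1 t -> spaced 0 n.+1 t' ->
  conv_roots b n.+1 a c t -> conv_roots b n.+1 a' c t' ->
  (forall i, (i.+1 < n.+1)%N -> a' i <= a i.+1) ->
  forall i, (i.+1 < n.+1)%N -> t' i <= t i.+1.
Proof.
move=> laws sa sa' sc st st' ra ra' le_a i i_n.
pose N := Num.max (a' n) (a n + b).
pose a2 i := if (i < n)%N then a i.+1 else N.
have sa2 : spaced b n.+1 a2.
  move=> j jn; rewrite /a2; have -> : (j < n)%N by [].
  case: ifP => j1n; first exact: sa.
  have -> : j.+1 = n by lia.
  by rewrite /N le_max lexx orbT.
have le_a2 j : (j < n.+1)%N -> a' j <= a2 j.
  move=> jn; rewrite /a2; case: ifP => j1n; first exact: le_a.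
  have -> : j = n by lia.
  by rewrite /N le_max lexx.
have sal : spaced b n (fun i => a i.+1) by move=> j jn; apply: sa.
have [s [kd [_ _ _ H]]] := conv_interlacing b_gt0 laws sal sc.
have [t1 [k1 [k10 E1 H1]]] := H (a 0); have [t2 [k2 [k20 E2 H2]]] := H N.
have r2 : conv_roots b n.+1 a2 c t2.
  exists k2 => //; rewrite -E2 rpSr /a2 ltnn; congr (conv _ (_ * _) _).
  by apply: eq_rp => j ->.
have le2 := conv_roots_mono laws sa' sa2 sc st' (interlacing_sorted H2) ra' r2 le_a2.
have r1 : conv_roots b n.+1 a c t1 by exists k1 => //; rewrite rpSl.
rewrite (conv_roots_inj st (interlacing_sorted H1) ra r1 i_n).
apply: le_trans (le2 i (ltnW i_n)) _.
have [h2 _] := H2 i i_n; have [_ h1] := H1 i i_n; exact: le_trans h2 h1.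
Qed.

Lemma conv_roots_shift n a c t : conv_roots b n a c t ->
  conv_roots b n (fun i => a i + b) c (fun i => t i + b).
Proof.
move=> [k k0 E]; exists k => //.
by rewrite -!shift_rp fdconv_shift // E comp_polyZ.
Qed.

(** The gaps of the new roots come from applying the interlacing law to a root
    vector and its translate by [b]. *)
Lemma conv_interlacing_lawsS n : conv_interlacing_laws b n -> conv_interlacing_laws b n.+1.
Proof.
move=> laws; split; last first.
- by move=> a a' c t t'; exact: conv_roots_interlace.
- by move=> a a' c t t'; exact: conv_roots_mono.
move=> a c sa sc; have [t st rt] := conv_roots_exist laws sa sc.
exists t => //.
apply: (conv_roots_interlace laws sa _ sc st _ rt (conv_roots_shift rt)) => //.
- by move=> i i_n; rewrite lerD2r sa.
- by move=> i i_n; rewrite addr0 lerD2r; have := st i i_n; rewrite addr0.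
Qed.

Lemma conv_interlacing_lawsT n : conv_interlacing_laws b n.
Proof.
elim: n => [|n]; first exact: conv_interlacing_laws0.
exact: conv_interlacing_lawsS.
Qed.

(** Distances between all pairs of roots reduce to consecutive gaps after
    sorting. *)
Lemma mesh_rpP p : mesh_ge b p <->
  p = 0 \/ exists n (k : R) t, [/\ k != 0, p = k *: rp n t & spaced b n t].
Proof.
split.
  have [-> | p0] := eqVneq p 0; first by left.
  case=> [/eqP|[rs Ers sep]]; first by rewrite (negPf p0).
  right; pose s := sort <=%R rs.
  have us : uniq s.
    rewrite sort_uniq; apply: pairwise_uniq sep => x /=.
    by rewrite subrr normr0 leNgt b_gt0.
  pose e (x y : R) := (x == y) || (b <= `|x - y|).
  have sep_s x y : x \in s -> y \in s -> x != y -> b <= `|x - y|.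
    rewrite !mem_sort => xs ys /negPf xy.
    have : pairwise e rs by apply: sub_pairwise sep => x1 y1 d1; rewrite /e d1 orbT.
    rewrite pairwise_all2rel; first by move/allrelP/(_ x y xs ys); rewrite /e xy.
      by move=> x1; rewrite /e eqxx.
    by move=> x1 y1; rewrite /e eq_sym distrC.
  exists (size s), (lead_coef p), (nth 0 s); split; first by rewrite lead_coef_eq0.
    rewrite {1}Ers; congr (_ *: _).
    rewrite /rp -(big_mkord xpredT (fun i => 'X - (nth 0 s i)%:P)).
    rewrite -(big_nth 0 xpredT (fun x => 'X - x%:P)); apply: perm_big.
    by rewrite perm_sym; apply/permPl/perm_sort.
  move=> i i_n; have i_n' := ltnW i_n.
  have le_i : nth 0 s i <= nth 0 s i.+1.
    by have /(sortedP 0) := sort_le_sorted rs; apply.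
  have := sep_s _ _ (mem_nth 0 i_n') (mem_nth 0 i_n).
  rewrite nth_uniq // => /(_ _)/wrap[]; first by rewrite ltn_eqF.
  by rewrite distrC ger0_norm ?subr_ge0 // lerBrDl.
case=> [->|[n [k [t [k0 -> st]]]]]; first by left.
right; exists (mkseq t n).
  rewrite /root_list lead_coefZ (monicP (monic_rp _ _)) mulr1; congr (_ *: _).
  by rewrite big_map -{2}[n]subn0 big_mkord.
apply/(pairwiseP 0) => i j; rewrite !inE size_mkseq => i_n j_n ij.
rewrite !nth_mkseq // distrC ger0_norm; last first.
  by rewrite subr_ge0; apply: spaced_le (ltW b_gt0) st _; rewrite ltnW.
by rewrite lerBrDl (spaced_lt b_gt0 st) // ij.
Qed.

Lemma mesh_fdiff p : mesh_ge b p -> mesh_ge b (D p).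
Proof.
move=> /mesh_rpP [->|[n [k [t [k0 -> st]]]]].
  by apply/mesh_rpP; left; rewrite fdiff0.
rewrite fdiffZ; apply/mesh_rpP; case: n st => [|n] st.
  left; rewrite rp0 (_ : D 1 = 0) ?scaler0 //.
  by apply: (iter_fdiff_eq0 b_gt0 (k := 1)); rewrite size_poly1.
right; have [u [-> Hu]] := fdiff_rp_roots b_gt0 st.
exists n, (k * n.+1%:R), u; split; first by rewrite mulf_neq0 // pnatr_eq0.
  by rewrite scalerA.
move=> i i_n; have [_ h1] := Hu i (ltnW i_n); have [h2 _] := Hu _ i_n.
by apply: le_trans _ h2; rewrite lerD2r.
Qed.

Lemma mesh_size n p : size p = n.+1 -> mesh_ge b p ->
  exists (k : R) t, [/\ k != 0, p = k *: rp n t & spaced b n t].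
Proof.
move=> szp /mesh_rpP [p0|[m [k [t [k0 E st]]]]]; first by rewrite p0 size_poly0 in szp.
have e : m = n by apply: succn_inj; rewrite -szp E size_scale // size_rp.
by exists k, t; rewrite -e.
Qed.

Lemma mesh_fdconv n p r : (size p <= n.+1)%N -> (size r <= n.+1)%N ->
  mesh_ge b p -> mesh_ge b r -> mesh_ge b (conv n p r).
Proof.
elim: n p r => [|n IH] p r szp szr mp mr.
  rewrite [r]size1_polyC // /fdconv big_ord1 /= hornerC.
  case/mesh_rpP: mp => [->|[n [k [t [k0 -> st]]]]].
    by apply/mesh_rpP; left; rewrite scaler0.
  apply/mesh_rpP; have [->|r0] := eqVneq r`_0 0; first by left; rewrite scale0r.
  by right; exists n, (r`_0 * k), t; rewrite scalerA mulf_neq0.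
have reduce (q h : {poly R}) : (size q <= n.+1)%N -> (size h <= n.+2)%N ->
    mesh_ge b q -> mesh_ge b h -> mesh_ge b (conv n.+1 q h).
  move=> szq szh mq mh; rewrite fdconvS //; apply: IH => //; last exact: mesh_fdiff.
  by apply: leq_trans (size_fdiff b_gt0 _) _; move: szh; lia.
have [szp'|szp'] := leqP (size p) n.+1; first exact: reduce.
have [szr'|szr'] := leqP (size r) n.+1; first by rewrite fdconvC //; exact: reduce.
have [k [a [k0 -> sa]]] := mesh_size (anti_leq (introT andP (conj szp szp'))) mp.
have [l [c [l0 -> sc]]] := mesh_size (anti_leq (introT andP (conj szr szr'))) mr.
have [ex _ _] := conv_interlacing_lawsT n.+1; have [t st [m m0 E]] := ex a c sa sc.
rewrite fdconvZl fdconvZr E !scalerA; apply/mesh_rpP; right.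
by exists n.+1, (k * l * m), t; split=> //; rewrite !mulf_neq0 // gt_eqF.
Qed.

End MainInduction.

Theorem theorem1p4 (R : realType) (n : nat) (b : R) (p r : {poly R}) :
  0 < b ->
  (size p <= n.+1)%N -> (size r <= n.+1)%N ->
  mesh_ge b p -> mesh_ge b r ->
  mesh_ge b (fdconv b n p r).
Proof. by move=> b0; exact: mesh_fdconv. Qed.
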